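(* Let $k$ be a field of characteristic zero and let $\mathfrak{g}$ be the free $4$-step nilpotent Lie algebra over $k$ on two generators $x_1,x_2$. Explicitly, $\mathfrak{g}$ has a basis $(x_1,\ldots,x_8)$ with Lie brackets \begin{align*} x_3&=[x_1,x_2],\\ x_4&=[x_1,[x_1,x_2]]=[x_1,x_3],\\ x_5&=[x_2,[x_1,x_2]]=[x_2,x_3],\\ x_6&=[x_1,[x_1,[x_1,x_2]]]=[x_1,x_4],\\ x_7&=[x_2,[x_1,[x_1,x_2]]]=[x_2,x_4]=[x_1,[x_2,[x_1,x_2]]]=[x_1,x_5],\\ x_8&=[x_2,[x_2,[x_1,x_2]]]=[x_2,x_5], \end{align*} all brackets of basis vectors not determined by these and skew-symmetry being zero. Then $\mathfrak{g}$ is a $2$-step solvable Lie algebra which does not admit any Novikov structure.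
   Context: A Lie algebra $\mathfrak{g}$ is called $p$-step solvable if $\mathfrak{g}^{(p+1)}=0$, where $\mathfrak{g}^{(1)}=\mathfrak{g}$ and $\mathfrak{g}^{(i+1)}=[\mathfrak{g}^{(i)},\mathfrak{g}^{(i)}]$; it is called $p$-step nilpotent if $\mathfrak{g}^{p+1}=0$, where $\mathfrak{g}^1=\mathfrak{g}$ and $\mathfrak{g}^{i+1}=[\mathfrak{g},\mathfrak{g}^i]$. A Novikov structure on a Lie algebra $\mathfrak{g}$ over $k$ is a $k$-bilinear product $(x,y)\mapsto x\cdot y$ on $\mathfrak{g}$ satisfying, for all $x,y,z\in\mathfrak{g}$: $x\cdot(y\cdot z)-(x\cdot y)\cdot z=y\cdot(x\cdot z)-(y\cdot x)\cdot z$ (left-symmetry), $(x\cdot y)\cdot z=(x\cdot z)\cdot y$, and $[x,y]=x\cdot y-y\cdot x$. *)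

(* Defs.v *)
From HB Require Import structures.
From mathcomp Require Import all_boot all_order all_algebra.

Set Implicit Arguments.
Unset Strict Implicit.
Unset Printing Implicit Defensive.

Import GRing.Theory.
Local Open Scope ring_scope.

HB.mixin Record Lmodule_isLieAlgebra (k : fieldType) (L : Type)
    of GRing.Lmodule k L := {
  lie : L -> L -> L;
  lie_bilinear : bilinear_for *:%R *:%R lie;
  liexx : forall x, lie x x = 0;
  lie_jacobi : forall x y z,
    lie x (lie y z) + lie y (lie z x) + lie z (lie x y) = 0
}.

#[short(type="lieAlgType")]
HB.structure Definition LieAlgebra (k : fieldType) :=
  { L of Lmodule_isLieAlgebra k L & GRing.Lmodule k L }.

Section LieTheory.
Variables (k : fieldType) (g : lieAlgType k).

(* [A, B] is the linear span of the brackets, not just the set of brackets. *)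
Inductive lie_span (A B : g -> Prop) : g -> Prop :=
| lie_span0 : lie_span A B 0
| lie_spanP (c : k) (a b u : g) :
    A a -> B b -> lie_span A B u -> lie_span A B (c *: lie a b + u).

(* Both series are numbered from 0 here: [derived_series i] is g^(i+1) in the
   convention g^(1) = g, and [lower_central i] is g^{i+1} with g^1 = g. *)
Fixpoint derived_series (i : nat) : g -> Prop :=
  if i is j.+1 then lie_span (derived_series j) (derived_series j)
  else fun _ => True.

Fixpoint lower_central (i : nat) : g -> Prop :=
  if i is j.+1 then lie_span (fun _ => True) (lower_central j)
  else fun _ => True.

Definition step_solvable (p : nat) : Prop :=
  forall u : g, derived_series p u -> u = 0.

Definition step_nilpotent (p : nat) : Prop :=
  forall u : g, lower_central p u -> u = 0.

(* The library's bases are for [vectType]; finite dimension is not assumed of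
   a [lieAlgType], so bases are defined here for arbitrary modules. *)
Definition lie_basis (n : nat) (e : n.-tuple g) : Prop :=
  (forall v : g, exists c : 'rV[k]_n, v = \sum_i c 0 i *: tnth e i) /\
  (forall c : 'rV[k]_n, \sum_i c 0 i *: tnth e i = 0 -> c = 0).

Definition novikov_structure (mul : g -> g -> g) : Prop :=
  [/\ bilinear_for *:%R *:%R mul,
      forall x y z,
        mul x (mul y z) - mul (mul x y) z = mul y (mul x z) - mul (mul y x) z,
      forall x y z, mul (mul x y) z = mul (mul x z) y
    & forall x y, lie x y = mul x y - mul y x].

End LieTheory.

Definition lie_hom (k : fieldType) (g h : lieAlgType k)
    (f : {linear g -> h}) : Prop :=
  forall x y, f (lie x y) = lie (f x) (f y).

(* Universal property of the free p-step nilpotent Lie algebra on the n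
   generators x. *)
Definition free_step_nilpotent (k : fieldType) (p n : nat) (g : lieAlgType k)
    (x : n.-tuple g) : Prop :=
  step_nilpotent g p /\
  forall (h : lieAlgType k) (y : n.-tuple h), step_nilpotent h p ->
    exists f : {linear g -> h},
      [/\ lie_hom f, map_tuple f x = y
        & forall f' : {linear g -> h},
            lie_hom f' -> map_tuple f' x = y -> f' =1 f].

(* Main.v *)
From HB Require Import structures.
Require Import Defs.
From mathcomp Require Import all_boot all_order all_algebra.
From mathcomp Require Import ssrAC ring.

(** Why the theorem holds.

The free 4-step nilpotent Lie algebra on two generators is identified with
[free_nil4], the row vectors of length 8 with the bracket read off from the
table.  Jacobi and nilpotency of this model are polynomial identities in the
coordinates, so the universal property gives f : g -> free_nil4.  Conversely,
in every 4-step nilpotent g the table defines a homomorphism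
[free_lift] : free_nil4 -> g; the only thing to check is that it commutes with
ad e1 and ad e2, because elements u for which it commutes with ad u are stable
under brackets.  Uniqueness in the universal property makes the composite on g
the identity, so f is an isomorphism.  Basis, brackets, solvability and the
absence of Novikov structures can then all be read off in the model.

For the last point, let x * y be a Novikov product in characteristic different
from 2 and 3, let M = [g, g], which is abelian and acted upon by the commuting
operators ad e1, ad e2, and put p = e3 * e3.  Combining left-symmetry with
commutation of right multiplications gives
  2 [y,z] * x = [x * y, z] + [y, x * z] - [x, [y,z]]      ([nov_mul_lie]),
so M is an ideal, and all products with an element of M on the left are
determined by the four products e_i * e_j with i, j <= 2.
For m, n in M this reads 2 [y,m] * n = [y, m * n]: the product on M is
governed by p.

- Comparing (e3 * x) * [y,e3] with ([y,e3] * x) * e3 gives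
  [x * y, p] = t(x) [y, p], with t(x) the e3-coordinate of e3 * x
  ([ad_p_mul]).  Since x * y and y * x agree modulo M, this says
  t(e1) [e2,p] = t(e2) [e1,p]; as the e4- and e5-coordinates of p are t(e2)/2
  and - t(e1)/2, both vanish.  So p is central and t(e1) = t(e2) = 0.
- With p central, the formula for e3 * [y,e3] yields
  [e1, [e2 * y, e3]] = [e2, [e1 * y, e3]], which forces every e_i * e_j into M
  ([mul_e_derived]).
- Left-symmetry applied to (e3, x, x) then becomes, for x = e1, e2 and
  r = e3 * x,
  2 (x * x)_3 p = [x + r_4 e1 + r_5 e2, r]                 ([square_coord3]).
  The coordinates of p and r that occur here are affine functions of the
  e3-coordinates of the e_i * e_j, and the resulting small quadratic system
  has no solution when 3 is invertible ([inconsistent_system]). *)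

Set Implicit Arguments.
Unset Strict Implicit.
Unset Printing Implicit Defensive.

Import GRing.Theory.
Local Open Scope ring_scope.

(** * Bilinear products and Lie algebras *)

Section Bilinear.
Variables (k : fieldType) (V : lmodType k) (f : V -> V -> V).
Hypothesis bil_f : bilinear_for *:%R *:%R f.

Lemma bilDl x y z : f (x + y) z = f x z + f y z.
Proof. by have := bil_f.1 z 1 x y => /=; rewrite !scale1r. Qed.
Lemma bilDr x y z : f z (x + y) = f z x + f z y.
Proof. by have := bil_f.2 z 1 x y => /=; rewrite !scale1r. Qed.
Lemma bil0l x : f 0 x = 0.
Proof. by apply: (addrI (f 0 x)); rewrite -bilDl !addr0. Qed.
Lemma bil0r x : f x 0 = 0.
Proof. by apply: (addrI (f x 0)); rewrite -bilDr !addr0. Qed.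
Lemma bilZl (c : k) x y : f (c *: x) y = c *: f x y.
Proof. by have := bil_f.1 y c x 0 => /=; rewrite bil0l !addr0. Qed.
Lemma bilZr (c : k) x y : f y (c *: x) = c *: f y x.
Proof. by have := bil_f.2 y c x 0 => /=; rewrite bil0r !addr0. Qed.
Lemma bilBl x y z : f (x - y) z = f x z - f y z.
Proof. by rewrite bilDl -scaleN1r bilZl scaleN1r. Qed.
Lemma bilBr x y z : f z (x - y) = f z x - f z y.
Proof. by rewrite bilDr -scaleN1r bilZr scaleN1r. Qed.

End Bilinear.

Section LieGeneral.
Variables (k : fieldType) (g : lieAlgType k).
Implicit Types x y z u v : g.

Definition lieDl := bilDl (@lie_bilinear k g).
Definition lieDr := bilDr (@lie_bilinear k g).
Definition lieZr := bilZr (@lie_bilinear k g).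
Definition lie0r := bil0r (@lie_bilinear k g).
Definition lieZl := bilZl (@lie_bilinear k g).

Lemma lie_antisym x y : lie x y = - lie y x.
Proof.
apply/eqP; rewrite -addr_eq0; apply/eqP.
by have := liexx (x + y); rewrite lieDl !lieDr !liexx addr0 add0r.
Qed.

Lemma lieNr x y : lie x (- y) = - lie x y.
Proof. by rewrite -scaleN1r lieZr scaleN1r. Qed.

Lemma lie_lie x y z : lie (lie x y) z = lie x (lie y z) - lie y (lie x z).
Proof.
have /eqP := lie_jacobi x y z; rewrite addr_eq0 => /eqP jac.
by rewrite (lie_antisym (lie x y)) -jac (lie_antisym z x) lieNr.
Qed.

Lemma lie_span_sub (A B P : g -> Prop) :
    P 0 -> (forall c a u, P a -> P u -> P (c *: a + u)) ->
    (forall a b, A a -> B b -> P (lie a b)) ->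
  forall u, lie_span A B u -> P u.
Proof.
move=> P0 PZD PAB u; elim=> // c a b v Aa Bb _ Pv.
by apply: PZD => //; apply: PAB.
Qed.

Lemma lie_span_lie (A B : g -> Prop) a b :
  A a -> B b -> lie_span A B (lie a b).
Proof.
move=> Aa Bb; have := lie_spanP 1 Aa Bb (lie_span0 A B).
by rewrite scale1r addr0.
Qed.

End LieGeneral.

(** * Transport along homomorphisms *)

Lemma derived_series_hom (k : fieldType) (g h : lieAlgType k)
    (f : {linear g -> h}) (hom_f : lie_hom f) i u :
  derived_series i u -> derived_series i (f u).
Proof.
elim: i u => [//|i IH]; apply: lie_span_sub => [|c a v Da Dv|a b /IH Ha /IH Hb].
- by rewrite linear0; apply: lie_span0.
- rewrite linearP.
  elim: Da => [|d a' b w Ha Hb _ Dw]; first by rewrite scaler0 add0r.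
  by rewrite scalerDr scalerA -addrA; apply: lie_spanP.
- by rewrite hom_f; apply: lie_span_lie.
Qed.

Lemma step_solvable_inj (k : fieldType) (g h : lieAlgType k)
    (f : {linear g -> h}) (hom_f : lie_hom f) p :
  injective f -> step_solvable h p -> step_solvable g p.
Proof.
move=> inj_f solv_h u /(derived_series_hom hom_f)/solv_h fu0.
by apply: inj_f; rewrite fu0 linear0.
Qed.

Lemma novikov_structure_iso (k : fieldType) (g h : lieAlgType k)
    (f : {linear g -> h}) (s : {linear h -> g}) (hom_f : lie_hom f) mul :
    cancel f s -> cancel s f ->
  novikov_structure mul ->
  novikov_structure (fun u v : h => f (mul (s u) (s v))).
Proof.
move=> fK sK [[mulPl mulPr] lsym rcomm lieE]; split.
- by split=> [w c u v|w c u v]; rewrite linearP ?mulPl ?mulPr linearP.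
- by move=> x y z; rewrite !fK -!linearB lsym.
- by move=> x y z; rewrite !fK rcomm.
- by move=> x y; rewrite -linearB -lieE hom_f !sK.
Qed.

(** * Identities in Novikov algebras *)

Section NovikovGeneral.
Variables (k : fieldType) (g : lieAlgType k) (mul : g -> g -> g).
Hypothesis nov : novikov_structure mul.
Local Notation "x • y" := (mul x y) (at level 40, left associativity).

Lemma nov_bil : bilinear_for *:%R *:%R mul.
Proof. by case: nov. Qed.

Lemma nov_lsym x y z :
  x • (y • z) = (x • y) • z + y • (x • z) - (y • x) • z.
Proof.
by case: nov => _ /(_ x y z) h _ _; rewrite -addrA -h addrCA subrr addr0.
Qed.
Lemma nov_rcomm x y z : (x • y) • z = (x • z) • y.
Proof. by case: nov. Qed.
Lemma nov_lie x y : lie x y = x • y - y • x.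
Proof. by case: nov. Qed.
Lemma nov_swap x y : x • y = y • x + lie x y.
Proof. by rewrite nov_lie addrC subrK. Qed.

(** Expanding x (y z - z y) by left-symmetry produces six products; four of
them make up the two brackets, and commutation of right multiplications turns
the remaining two into (y z) x and (z y) x. *)
Lemma nov_anticomm x y z :
  x • lie y z + lie y z • x = lie (x • y) z + lie y (x • z).
Proof.
rewrite !nov_lie !(bilBr nov_bil) !(bilBl nov_bil).
rewrite (nov_lsym x y z) (nov_lsym x z y).
rewrite (nov_rcomm y z x) (nov_rcomm z y x) !opprD !opprK.
move: (_ • z) (y • _) ((y • x) • z) ((x • z) • y) (z • _) ((z • x) • y).
move=> xyz yxz yx_z xz_y zxy zx_y.
rewrite [LHS](AC (3*3*2) ((1*5)*(2*4)*(3*7)*(6*8))) /=.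
by rewrite (addNr yx_z) (subrr zx_y) !addr0.
Qed.

Hypothesis nz2 : (2 : k) != 0.

(** In characteristic different from 2, products with a bracket on the left are
determined by products with its entries on the right; in particular the
bracket of two ideals is an ideal. *)
Lemma nov_mul_lie x y z :
  lie y z • x = 2^-1 *: (lie (x • y) z + lie y (x • z) - lie x (lie y z)).
Proof.
apply: (scalerI nz2); rewrite scalerA mulfV // scale1r -nov_anticomm.
rewrite (nov_swap x) addrAC addrK.
by rewrite scaler_nat mulr2n.
Qed.

End NovikovGeneral.

(** * The coordinate model *)

Section Model.
Variable k : fieldType.

Definition free_nil4 := 'rV[k]_8.
HB.instance Definition _ := GRing.Lmodule.on free_nil4.

(** Coordinates and basis vectors are numbered from 1, so that [coord 3] and
[std 3] belong to x_3. *)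
Definition coord (n : nat) (v : free_nil4) : k := v 0 (inord n.-1).
Arguments coord n%_N v.
Definition std (n : nat) : free_nil4 := \row_(i < 8) (i == n.-1 :> nat)%:R.

Arguments std n%_N.
Local Notation e := std.

Lemma coordD n u v : coord n (u + v) = coord n u + coord n v.
Proof. by rewrite /coord mxE. Qed.
Lemma coordN n u : coord n (- u) = - coord n u.
Proof. by rewrite /coord mxE. Qed.
Lemma coordZ n c u : coord n (c *: u) = c * coord n u.
Proof. by rewrite /coord mxE. Qed.
Lemma coord0 n : coord n 0 = 0.
Proof. by rewrite /coord mxE. Qed.
Lemma coord_e m n : (m.-1 < 8)%N -> coord m (e n) = (m.-1 == n.-1)%:R.
Proof. by move=> lt_m; rewrite /coord mxE inordK. Qed.

Lemma free_nil4_eq u v :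
    [/\ coord 1 u = coord 1 v, coord 2 u = coord 2 v,
        coord 3 u = coord 3 v & coord 4 u = coord 4 v] ->
    [/\ coord 5 u = coord 5 v, coord 6 u = coord 6 v,
        coord 7 u = coord 7 v & coord 8 u = coord 8 v] ->
  u = v.
Proof.
case=> h1 h2 h3 h4 [h5 h6 h7 h8]; apply/rowP=> i.
suff: coord i.+1 u = coord i.+1 v by rewrite /coord inord_val.
by case: i => [[|[|[|[|[|[|[|[|i]]]]]]]] lt_i].
Qed.

(** The coefficient of [x_i, x_j] when [u, v] is expanded by bilinearity. *)
Definition minor (i j : nat) (u v : free_nil4) : k :=
  coord i u * coord j v - coord j u * coord i v.
Arguments minor (i j)%_N u v.

Definition free_nil4_lie (u v : free_nil4) : free_nil4 :=
  \row_(i < 8) [:: 0; 0; minor 1 2 u v; minor 1 3 u v; minor 2 3 u v;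
     minor 1 4 u v; minor 2 4 u v + minor 1 5 u v; minor 2 5 u v]`_i.

Fact coord_free_nil4_lie u v :
  (coord 1 (free_nil4_lie u v) = 0) *
  (coord 2 (free_nil4_lie u v) = 0) *
  (coord 3 (free_nil4_lie u v) = minor 1 2 u v) *
  (coord 4 (free_nil4_lie u v) = minor 1 3 u v) *
  (coord 5 (free_nil4_lie u v) = minor 2 3 u v) *
  (coord 6 (free_nil4_lie u v) = minor 1 4 u v) *
  (coord 7 (free_nil4_lie u v) = minor 2 4 u v + minor 1 5 u v) *
  (coord 8 (free_nil4_lie u v) = minor 2 5 u v).
Proof. by rewrite /coord !mxE !inordK. Qed.

Lemma minorE i j u v :
  minor i j u v = coord i u * coord j v - coord j u * coord i v.
Proof. by []. Qed.

Definition linE := (coordD, coordN, coordZ, coord0, minorE).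

Fact free_nil4_bilinear : bilinear_for *:%R *:%R free_nil4_lie.
Proof.
by split=> w c u v; apply: free_nil4_eq; split;
  rewrite !(linE, coord_free_nil4_lie); ring.
Qed.

Fact free_nil4_liexx u : free_nil4_lie u u = 0.
Proof.
by apply: free_nil4_eq; split; rewrite !(linE, coord_free_nil4_lie); ring.
Qed.

Fact free_nil4_jacobi u v w :
  free_nil4_lie u (free_nil4_lie v w) + free_nil4_lie v (free_nil4_lie w u) +
  free_nil4_lie w (free_nil4_lie u v) = 0.
Proof.
by apply: free_nil4_eq; split; rewrite !(linE, coord_free_nil4_lie); ring.
Qed.

HB.instance Definition _ := Lmodule_isLieAlgebra.Build k free_nil4
  free_nil4_bilinear free_nil4_liexx free_nil4_jacobi.

Definition coord_lie u v :
  (coord 1 (lie u v) = 0) *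
  (coord 2 (lie u v) = 0) *
  (coord 3 (lie u v) = minor 1 2 u v) *
  (coord 4 (lie u v) = minor 1 3 u v) *
  (coord 5 (lie u v) = minor 2 3 u v) *
  (coord 6 (lie u v) = minor 1 4 u v) *
  (coord 7 (lie u v) = minor 2 4 u v + minor 1 5 u v) *
  (coord 8 (lie u v) = minor 2 5 u v) := coord_free_nil4_lie u v.

Definition coordE := (linE, coord_lie, coord_e).

Lemma decomp (v : free_nil4) : v = \sum_(i < 8) coord i.+1 v *: e i.+1.
Proof.
rewrite !big_ord_recl big_ord0.
by apply: free_nil4_eq; split; rewrite !coordE //=; ring.
Qed.

Definition vanish (s : seq nat) (v : free_nil4) : bool :=
  all (fun n => coord n v == 0) s.

(** The terms of the lower central series vanish in the coordinates of lower
degree, the degrees of x_1, ..., x_8 being 1, 1, 2, 3, 3, 4, 4, 4. *)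
Lemma free_nil4_nilpotent : step_nilpotent free_nil4 4.
Proof.
have step i s t : (forall u, lower_central i u -> vanish s u) ->
    (forall a b, vanish s b -> vanish t (lie a b)) ->
  forall u, lower_central i.+1 u -> vanish t u.
  move=> lc_s lie_t; apply: lie_span_sub => [|c a u /allP a0 /allP u0|a b _ lb].
  - by apply/allP=> n _; rewrite coord0.
  - apply/allP=> n tn; rewrite !linE (eqP (a0 n tn)) (eqP (u0 n tn)).
    by rewrite mulr0 addr0.
  - exact/lie_t/lc_s.
have lc1 : forall u, lower_central 1 u -> vanish [:: 1; 2]%N u.
  by apply: (step 0 [::]) => // a b _; rewrite /= !coordE eqxx.
have lc2 : forall u, lower_central 2 u -> vanish [:: 1; 2; 3]%N u.
  apply: (step _ _ _ lc1) => a b /and3P[/eqP b1 /eqP b2 _].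
  by rewrite /= !coordE b1 b2 !mulr0 subrr eqxx.
have lc3 : forall u, lower_central 3 u -> vanish [:: 1; 2; 3; 4; 5]%N u.
  apply: (step _ _ _ lc2) => a b /and4P[/eqP b1 /eqP b2 /eqP b3 _].
  by rewrite /= !coordE b1 b2 b3 !mulr0 subrr eqxx.
have lc4 :
    forall u, lower_central 4 u -> vanish [:: 1; 2; 3; 4; 5; 6; 7; 8]%N u.
  apply: (step _ _ _ lc3) => a b.
  move=> /and5P[/eqP b1 /eqP b2 /eqP b3 /eqP b4 /andP[/eqP b5 _]].
  by rewrite /= !coordE b1 b2 b3 b4 b5 !mulr0 subrr addr0 eqxx.
move=> u /lc4 /and5P[/eqP u1 /eqP u2 /eqP u3 /eqP u4].
move=> /and5P[/eqP u5 /eqP u6 /eqP u7 /eqP u8 _].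
by apply: free_nil4_eq; rewrite !coord0.
Qed.

(** The vectors of degree at least 2; they form the derived algebra M. *)
Definition in_derived (v : free_nil4) : Prop := coord 1 v = 0 /\ coord 2 v = 0.

Lemma lie_in_derived u v : in_derived (lie u v).
Proof. by split; rewrite coord_lie. Qed.

(** M is abelian for reasons of degree: the only bracket inside M that could reach
degree 4 is [x_3, x_3] = 0. *)
Lemma lie_derived0 u v : in_derived u -> in_derived v -> lie u v = 0.
Proof.
move=> [u1 u2] [v1 v2]; apply: free_nil4_eq; split;
  by rewrite !coordE ?u1 ?u2 ?v1 ?v2; ring.
Qed.

Lemma free_nil4_solvable : step_solvable free_nil4 2.
Proof.
have derived1 : forall u : free_nil4, derived_series 1 u -> in_derived u.
  apply: lie_span_sub => [|c a u [a1 a2] [u1 u2]|a b _ _].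
  - by split; rewrite coord0.
  - by split; rewrite !linE ?a1 ?a2 ?u1 ?u2 mulr0 addr0.
  - exact: lie_in_derived.
move=> u; apply: (lie_span_sub (P := fun v => v = 0)) => //.
  by move=> c a w -> ->; rewrite scaler0 addr0.
by move=> a b /derived1 Ha /derived1 Hb; apply: lie_derived0.
Qed.

Lemma lie_e :
  (lie (e 1) (e 2) = e 3) * (lie (e 1) (e 3) = e 4) * (lie (e 2) (e 3) = e 5) *
  (lie (e 1) (e 4) = e 6) * (lie (e 2) (e 4) = e 7) * (lie (e 1) (e 5) = e 7) *
  (lie (e 2) (e 5) = e 8).
Proof.
by do !split; apply: free_nil4_eq; split; rewrite !coordE //=; ring.
Qed.

Lemma lie_e0 :
  (lie (e 1) (e 6) = 0) * (lie (e 1) (e 7) = 0) * (lie (e 1) (e 8) = 0) *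
  (lie (e 2) (e 6) = 0) * (lie (e 2) (e 7) = 0) * (lie (e 2) (e 8) = 0).
Proof.
by do !split; apply: free_nil4_eq; split; rewrite !coordE //=; ring.
Qed.

End Model.

(** * No Novikov structure on the model *)

(** In the application x, y are the e4- and e5-coordinates of e3 * e1, z, t those
of e3 * e2, and bij is the e3-coordinate of e_i * e_j.  The middle equations
read 2 y^2 = y^2 and 2 z^2 = z^2, so y = z = 0 and b11 = b22 = 0; then x and t
lie in {0, -1}, while 2 x + 2 t = -1. *)
Lemma inconsistent_system (k : fieldType) (x y z t b11 b12 b21 b22 p6 p8 : k) :
    (3 : k) != 0 ->
    [/\ 2 * x = b12 - 1, 2 * y = - b11, 2 * z = b22 & 2 * t = - b21 - 1] ->
    2 * p6 = z -> 2 * p8 = - y -> b12 = b21 + 1 ->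
    [/\ 2 * (b11 * p6) = (1 + x) * x, 2 * (b11 * p8) = y * y,
        2 * (b22 * p6) = z * z & 2 * (b22 * p8) = (1 + t) * t] ->
  False.
Proof.
move=> nz3 [x_b y_b z_b t_b] p6_z p8_y b_anti [eq_x eq_y eq_z eq_t].
have y0 : y = 0.
  apply/eqP; rewrite -sqrf_eq0 expr2; apply/eqP/(addrI (y * y)).
  rewrite addr0 -[RHS]eq_y mulrCA p8_y -[b11]opprK -y_b; ring.
have z0 : z = 0.
  apply/eqP; rewrite -sqrf_eq0 expr2; apply/eqP/(addrI (z * z)).
  rewrite addr0 -[RHS]eq_z mulrCA p6_z -z_b; ring.
have b11_0 : b11 = 0 by apply: oppr_inj; rewrite -y_b y0 mulr0 oppr0.
have b22_0 : b22 = 0 by rewrite -z_b z0 mulr0.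
have xt : 2 * x + 2 * t = - 1 by rewrite x_b t_b b_anti; ring.
have /eqP := eq_x; rewrite b11_0 mul0r mulr0 eq_sym mulf_eq0 addrC addr_eq0.
have /eqP := eq_t; rewrite b22_0 mul0r mulr0 eq_sym mulf_eq0 addrC addr_eq0.
move=> /orP[]/eqP t_v /orP[]/eqP x_v; move/eqP: xt;
  rewrite x_v t_v -subr_eq0.
- by rewrite (_ : _ - _ = - 3) ?oppr_eq0 ?(negPf nz3) //; ring.
- by rewrite (_ : _ - _ = - 1) ?oppr_eq0 ?oner_eq0 //; ring.
- by rewrite (_ : _ - _ = - 1) ?oppr_eq0 ?oner_eq0 //; ring.
- by rewrite (_ : _ - _ = 1) ?oner_eq0 //; ring.
Qed.

Section NoNovikov.
Variables (k : fieldType).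
Variable mul : free_nil4 k -> free_nil4 k -> free_nil4 k.
Hypothesis nov : novikov_structure mul.
Hypothesis nz2 : (2 : k) != 0.
Hypothesis nz3 : (3 : k) != 0.
Local Notation "x • y" := (mul x y) (at level 40, left associativity).
Local Notation e := (@std k).
Local Notation p := (e 3 • e 3).
Implicit Types u v w x y z m n : free_nil4 k.

Let mulDl := bilDl (nov_bil nov).
Let mulZl := bilZl (nov_bil nov).

(** M is spanned by brackets, each with a generator as first entry: this is the
form to which the formula for [y,m] * x applies. *)
Lemma derived_decomp v : in_derived v ->
  v = coord 3 v *: lie (e 1) (e 2) + coord 4 v *: lie (e 1) (e 3)
      + coord 5 v *: lie (e 2) (e 3) + coord 6 v *: lie (e 1) (e 4)
      + coord 7 v *: lie (e 1) (e 5) + coord 8 v *: lie (e 2) (e 5).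
Proof.
case=> v1 v2; rewrite !lie_e; apply: free_nil4_eq; split;
  by rewrite !coordE //= ?v1 ?v2; ring.
Qed.

Lemma lie_mul_derived x y z : in_derived (lie y z • x).
Proof. by rewrite (nov_mul_lie nov) //; split; rewrite !coordE; ring. Qed.

Lemma derived_mul v x : in_derived v -> in_derived (v • x).
Proof.
move/derived_decomp->; rewrite !mulDl !mulZl; split;
 by rewrite !linE ?(lie_mul_derived _ _ _).1 ?(lie_mul_derived _ _ _).2; ring.
Qed.

(** Replacing x * m by m * x + [x,m] in [nov_mul_lie] absorbs the double bracket:
by Jacobi the discrepancy is [[y,x],m], a bracket inside M. *)
Lemma mul_lie_derived x y m : in_derived m ->
  lie y m • x = 2^-1 *: (lie (x • y) m + lie y (m • x)).
Proof.
move=> m_der; have [m1 m2] := m_der.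
have [mx1 mx2] := derived_mul x m_der.
rewrite (nov_mul_lie nov) // (nov_swap nov x m); congr (_ *: _).
by apply: free_nil4_eq; split; rewrite !coordE ?m1 ?m2 ?mx1 ?mx2; ring.
Qed.

(** On M, multiplication is compatible with ad y up to the factor 1/2, so it is
determined by p. *)
Lemma derived_mul_derived y m n : in_derived m -> in_derived n ->
  lie y m • n = 2^-1 *: lie y (m • n).
Proof.
move=> Hm Hn; rewrite mul_lie_derived // (@lie_derived0 _ (n • y)) ?add0r //.
exact: derived_mul.
Qed.

Lemma derived_mulC m n : in_derived m -> in_derived n -> m • n = n • m.
Proof. by move=> Hm Hn; rewrite (nov_swap nov) lie_derived0 ?addr0. Qed.

Lemma e_derived i : (2 < i <= 8)%N -> in_derived (e i).
Proof. by case: i => [|[|[|i]]] //= lt_i; split; rewrite !coordE. Qed.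

Let d3 : in_derived (e 3). Proof. exact: e_derived. Qed.
Let p_derived : in_derived p. Proof. exact: derived_mul. Qed.

Lemma mul_e3 x :
  2 *: (e 3 • x) = lie (x • e 1) (e 2) + lie (e 1) (x • e 2) - lie x (e 3).
Proof.
by rewrite -(lie_e k).1.1.1.1.1.1 (nov_mul_lie nov) // scalerA mulfV // scale1r.
Qed.

Lemma pE : 2 *: p = lie (e 1) (e 3 • e 2) - lie (e 2) (e 3 • e 1).
Proof.
by rewrite mul_e3 liexx subr0 addrC; congr (_ + _); rewrite lie_antisym.
Qed.

(** p lies in the span of [e1,M] and [e2,M] because e3 = [e1,e2]; up to sign
and a factor 2 its coordinates are those of e3 * e2 and e3 * e1, shifted by one
degree. *)
Lemma coord_p :
  (coord 3 p = 0) * (2 * coord 4 p = coord 3 (e 3 • e 2)) *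
  (2 * coord 5 p = - coord 3 (e 3 • e 1)) *
  (2 * coord 6 p = coord 4 (e 3 • e 2)) *
  (2 * coord 8 p = - coord 5 (e 3 • e 1)).
Proof.
have [r1 r1'] := derived_mul (e 1) d3; have [r2 r2'] := derived_mul (e 2) d3.
have H (i : nat) := congr1 (@coord k i) pE.
split; [split; [split; [split|]|]|]; [apply: (mulfI nz2)| | | |].
- by have := H 3; rewrite !coordE //= ?(r1, r1', r2, r2') => ->; ring.
- by have := H 4; rewrite !coordE //= ?(r1, r1', r2, r2') => ->; ring.
- by have := H 5; rewrite !coordE //= ?(r1, r1', r2, r2') => ->; ring.
- by have := H 6; rewrite !coordE //= ?(r1, r1', r2, r2') => ->; ring.
- by have := H 8; rewrite !coordE //= ?(r1, r1', r2, r2') => ->; ring.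
Qed.

(** The degree-4 part of v contributes nothing: its product with e3 is a double
bracket of p, and p has degree at least 3. *)
Lemma derived_mul_e3 v : in_derived v ->
  v • e 3 = coord 3 v *: p
            + 2^-1 *: lie (coord 4 v *: e 1 + coord 5 v *: e 2) p.
Proof.
move=> Hv; rewrite {1}(derived_decomp Hv) !mulDl !mulZl.
rewrite -[e 4](lie_e k).1.1.1.1.1.2 -[e 5](lie_e k).1.1.1.1.2.
rewrite (lie_e k).1.1.1.1.1.1.
rewrite !derived_mul_derived //; try exact: lie_in_derived.
have [p1 p2] := p_derived; apply: free_nil4_eq; split;
  by rewrite !coordE //= ?p1 ?p2 ?coord_p; ring.
Qed.

Lemma derived_mul_lie_e3 v y : in_derived v ->
  v • lie y (e 3) = 2^-1 *: (coord 3 v *: lie y p).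
Proof.
move=> Hv; rewrite (derived_mulC Hv (lie_in_derived _ _)) derived_mul_derived //.
rewrite [e 3 • v]derived_mulC // derived_mul_e3 //.
have [p1 p2] := p_derived; apply: free_nil4_eq; split;
  by rewrite !coordE //= ?p1 ?p2 ?coord_p; ring.
Qed.

(** Right multiplications by e3, x and [y,e3] commute and the product on M is
commutative, so (e3 * x) * [y,e3] = ([y,e3] * x) * e3; both sides are brackets
with p by the two preceding lemmas. *)
Lemma ad_p_mul x y : lie (x • y) p = coord 3 (e 3 • x) *: lie y p.
Proof.
have [r1 r2] := derived_mul x d3; have [p1 p2] := p_derived.
have := nov_rcomm nov (e 3) x (lie y (e 3)).
rewrite derived_mul_lie_e3; last exact: derived_mul.
rewrite (derived_mulC d3 (lie_in_derived y (e 3))).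
rewrite (nov_rcomm nov) (derived_mul_e3 (lie_mul_derived _ _ _)).
set w := lie y (e 3) • x.
have wE : 2 *: w = lie (x • y) (e 3) + lie y (e 3 • x).
  by rewrite /w mul_lie_derived // scalerA mulfV // scale1r.
have w3 : coord 3 w = 0.
  by apply: (mulfI nz2); rewrite -coordZ wE !coordE //= ?r1 ?r2; ring.
have lie_w : 2 *: lie (coord 4 w *: e 1 + coord 5 w *: e 2) p
    = lie (x • y) p + coord 3 (e 3 • x) *: lie y p.
  have w4 : 2 * coord 4 w = coord 1 (x • y) + coord 3 (e 3 • x) * coord 1 y.
    by rewrite -coordZ wE !coordE //= ?r1 ?r2; ring.
  have w5 : 2 * coord 5 w = coord 2 (x • y) + coord 3 (e 3 • x) * coord 2 y.
    by rewrite -coordZ wE !coordE //= ?r1 ?r2; ring.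
  rewrite -(lieZl 2) scalerDr !scalerA w4 w5.
  by apply: free_nil4_eq; split; rewrite !coordE //= ?p1 ?p2 ?coord_p; ring.
rewrite w3 scale0r add0r => /(scalerI (invr_neq0 nz2)) eq_p.
apply: (addIr (coord 3 (e 3 • x) *: lie y p)).
by rewrite -lie_w -eq_p scaler_nat mulr2n.
Qed.

(** The element e1 * e2 - e2 * e1 lies in M and so commutes with p; hence
t(e1) [e2,p] = t(e2) [e1,p] for t(x) the e3-coordinate of e3 * x.  The
coordinates of this equation involve the degree-3 part of p, which [coord_p]
expresses by the same two scalars, so that the squares of these vanish. *)
Lemma e3_mul_coord3 : [/\ coord 3 (e 3 • e 1) = 0, coord 3 (e 3 • e 2) = 0,
  coord 4 p = 0 & coord 5 p = 0].
Proof.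
have [p1 p2] := p_derived.
have eq_p :
    coord 3 (e 3 • e 1) *: lie (e 2) p = coord 3 (e 3 • e 2) *: lie (e 1) p.
  rewrite -!ad_p_mul (nov_swap nov) lieDl (lie_derived0 (lie_in_derived _ _)) //.
  by rewrite addr0.
have [h6 h8] := (congr1 (@coord k 6) eq_p, congr1 (@coord k 8) eq_p).
rewrite !coordE //= in h6 h8.
rewrite !(mul0r, mul1r, subr0, mulr0) in h6 h8.
have p4 : coord 4 p = 0.
  apply/eqP; rewrite -sqrf_eq0 -(mulrI_eq0 _ (mulfI nz2)).
  by rewrite expr2 mulrA coord_p -h6.
have p5 : coord 5 p = 0.
  apply/eqP; rewrite -sqrf_eq0 -(mulrI_eq0 _ (mulfI nz2)).
  by rewrite expr2 mulrA coord_p mulNr h8 oppr0.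
have [[[[_ cp4] cp5] _] _] := coord_p.
split=> //; first by apply: oppr_inj; rewrite -cp5 p5 mulr0 oppr0.
by rewrite -cp4 p4 mulr0.
Qed.

Let p_center y : lie y p = 0.
Proof.
have [p1 p2] := p_derived; have [_ _ p4 p5] := e3_mul_coord3.
by apply: free_nil4_eq; split; rewrite !coordE ?p1 ?p2 ?p4 ?p5 ?coord_p; ring.
Qed.

(** For h = [y,e3] the product e3 * h = [y,p]/2 vanishes.  Expanding it with
e3 = [e1,e2] gives [e1, h * e2] = [e2, h * e1], and the degree-3 part of h * x
is [x * y, e3]/2. *)
Lemma mul_e12_coords y :
  [/\ coord 1 (e 2 • y) = 0, coord 2 (e 1 • y) = 0
    & coord 1 (e 1 • y) = coord 2 (e 2 • y)].
Proof.
pose h := lie y (e 3).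
have h_der : in_derived h by exact: lie_in_derived.
have eq_h : lie (e 1) (h • e 2) = lie (e 2) (h • e 1).
  have := mul_e3 h; rewrite [e 3 • h]derived_mulC // derived_mul_derived //.
  rewrite p_center !scaler0 (lie_derived0 h_der d3) subr0 lie_antisym addrC.
  by move/esym/eqP; rewrite subr_eq0 => /eqP.
have [r13 r23 _ _] := e3_mul_coord3.
have h_coords x : coord 3 (e 3 • x) = 0 ->
    2 * coord 4 (h • x) = coord 1 (x • y) /\
    2 * coord 5 (h • x) = coord 2 (x • y).
  move=> r3; have [r1 r2] := derived_mul x d3.
  rewrite -!coordZ mul_lie_derived // scalerA mulfV // scale1r.
  by split; rewrite !coordE //= ?r1 ?r2 r3; ring.
have [h14 h15] := h_coords _ r13; have [h24 h25] := h_coords _ r23.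
rewrite -h14 -h15 -h24 -h25.
have H (i : nat) := congr1 (@coord k i) eq_h.
split.
- have := H 6%N; rewrite !coordE //= !(mul0r, mul1r, oppr0, add0r, addr0) => ->.
  by rewrite mulr0.
- have := H 8%N; rewrite !coordE //= !(mul0r, mul1r, oppr0, add0r, addr0) => <-.
  by rewrite mulr0.
- have := H 7%N.
  by rewrite !coordE //= !(mul0r, mul1r, oppr0, add0r, addr0) => ->.
Qed.

(** The preceding relations for y = e1 and y = e2 leave nothing, since e1 * e2
and e2 * e1 agree modulo M. *)
Lemma mul_e_derived i j :
  (0 < i <= 2)%N -> (0 < j <= 2)%N -> in_derived (e i • e j).
Proof.
have [h1 h2 h3] := mul_e12_coords (e 1).
have [h4 h5 h6] := mul_e12_coords (e 2).
have [s1 s2] := lie_in_derived (e 1) (e 2).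
have a1 : coord 1 (e 1 • e 2) = 0.
  by rewrite (nov_swap nov) coordD h1 s1 addr0.
have a2 : coord 2 (e 2 • e 1) = 0.
  by have := h5; rewrite (nov_swap nov) coordD s2 addr0.
rewrite a1 in h6; rewrite a2 in h3.
by case: i => [|[|[|i]]] // _; case: j => [|[|[|j]]].
Qed.

(** The hypotheses on x hold for e1 and e2 by the results above. *)
Section Square.
Variable x : free_nil4 k.
Hypothesis x1_der : in_derived (x • e 1).
Hypothesis x2_der : in_derived (x • e 2).
Hypothesis xx_der : in_derived (x • x).
Hypothesis r3 : coord 3 (e 3 • x) = 0.
Local Notation r := (e 3 • x).

(** Only the degree-3 part of v counts, as e6, e7, e8 contribute double brackets of
r and r has no component in degree 2. *)
Lemma gamma3_mul v : in_derived v -> coord 3 v = 0 ->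
  v • x = 2^-1 *: lie (coord 4 v *: e 1 + coord 5 v *: e 2) r.
Proof.
move=> v_der v3.
have mul1 m : in_derived m -> lie (e 1) m • x = 2^-1 *: lie (e 1) (m • x).
  by move=> m_der; rewrite mul_lie_derived // (lie_derived0 x1_der) // add0r.
have mul2 m : in_derived m -> lie (e 2) m • x = 2^-1 *: lie (e 2) (m • x).
  by move=> m_der; rewrite mul_lie_derived // (lie_derived0 x2_der) // add0r.
rewrite {1}(derived_decomp v_der) !mulDl !mulZl v3 scale0r add0r.
rewrite -[e 4](lie_e k).1.1.1.1.1.2 -[e 5](lie_e k).1.1.1.1.2.
rewrite !(mul1, mul2) //; try exact: lie_in_derived.
have [r1 r2] := derived_mul x d3.
apply: free_nil4_eq; split; by rewrite !coordE //= ?r1 ?r2 ?r3; ring.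
Qed.

(** Left-symmetry for (e3, x, x), with x * r and x * e3 rewritten as r * x + [x,r]
and r + [x,e3]. *)
Lemma square_coord3 :
  2 *: (coord 3 (x • x) *: p)
  = lie (x + coord 4 r *: e 1 + coord 5 r *: e 2) r.
Proof.
have r_der := derived_mul x d3.
have := nov_lsym nov (e 3) x x.
rewrite (derived_mulC d3 xx_der) derived_mul_e3 // p_center scaler0 addr0.
rewrite (nov_swap nov x r) (nov_swap nov x (e 3)) mulDl.
rewrite mul_lie_derived // (lie_derived0 xx_der d3) add0r.
rewrite (gamma3_mul r_der r3) => ->.
rewrite -[x + _ + _]addrA [RHS]lieDl; set A := lie x r; set Z := lie _ r.
rewrite [_ + (_ + A)]addrC addrKA scalerBr scalerDr !scalerA mulfV // !scale1r.
by rewrite scaler_nat mulr2n addrA addrK addrC.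
Qed.
End Square.

Lemma novikov_free_nil4_false : False.
Proof.
have [r13 r23 _ _] := e3_mul_coord3.
have [a11 a12] := (@mul_e_derived 1 1 isT isT, @mul_e_derived 1 2 isT isT).
have [a21 a22] := (@mul_e_derived 2 1 isT isT, @mul_e_derived 2 2 isT isT).
have [r11 r12] := derived_mul (e 1) d3; have [r21 r22] := derived_mul (e 2) d3.
have r_coords x : 2 * coord 4 (e 3 • x) = coord 3 (x • e 2) - coord 1 x /\
    2 * coord 5 (e 3 • x) = - coord 3 (x • e 1) - coord 2 x.
  by rewrite -!coordZ mul_e3; split; rewrite !coordE //=; ring.
have [r14 r15] := r_coords (e 1); have [r24 r25] := r_coords (e 2).
rewrite !coord_e //= in r14 r15 r24 r25.
have eq_m : coord 3 (e 1 • e 2) = coord 3 (e 2 • e 1) + 1.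
  by rewrite (nov_swap nov) coordD lie_e coord_e.
have [[[[_ _] _] p6] p8] := coord_p.
have sq1 (i : nat) := congr1 (@coord k i) (square_coord3 a11 a12 a11 r13).
have sq2 (i : nat) := congr1 (@coord k i) (square_coord3 a21 a22 a22 r23).
have := (sq1 6%N, sq1 8%N, sq2 6%N, sq2 8%N).
rewrite !coordE //= r11 r12 r21 r22.
rewrite !(mul0r, mulr0, mulr1, subr0, addr0, add0r) => -[[[eq6 eq8] eq6'] eq8'].
rewrite !subr0 in r15 r24.
exact: (inconsistent_system nz3 (And4 r14 r15 r24 r25) p6 p8 eq_m
  (And4 eq6 eq8 eq6' eq8')).
Qed.

End NoNovikov.

(** * Homomorphisms out of the model *)

Section Lift.
Variables (k : fieldType) (g : lieAlgType k) (x1 x2 : g).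
Local Notation e := (@std k).

Definition hall_tuple : 8.-tuple g :=
  let x3 := lie x1 x2 in let x4 := lie x1 x3 in let x5 := lie x2 x3 in
  [tuple x1; x2; x3; x4; x5; lie x1 x4; lie x2 x4; lie x2 x5].

Definition free_lift (v : free_nil4 k) : g := \sum_i v 0 i *: tnth hall_tuple i.

Fact free_lift_is_linear : linear free_lift.
Proof.
move=> c u v; rewrite /free_lift scaler_sumr -big_split /=.
by apply: eq_bigr => i _; rewrite !mxE scalerDl scalerA.
Qed.
HB.instance Definition _ :=
  GRing.isLinear.Build k (free_nil4 k) g *:%R free_lift free_lift_is_linear.

Lemma free_lift_e (i : 'I_8) : free_lift (e i.+1) = tnth hall_tuple i.
Proof.
rewrite /free_lift (bigD1 i) //= mxE eqxx scale1r big1 ?addr0 // => j ne_ji.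
by rewrite mxE [_ == _](negPf ne_ji) scale0r.
Qed.

Lemma free_lift_eE :
  (free_lift (e 1) = x1) * (free_lift (e 2) = x2) *
  (free_lift (e 3) = lie x1 x2) *
  (free_lift (e 4) = lie x1 (lie x1 x2)) *
  (free_lift (e 5) = lie x2 (lie x1 x2)) *
  (free_lift (e 6) = lie x1 (lie x1 (lie x1 x2))) *
  (free_lift (e 7) = lie x2 (lie x1 (lie x1 x2))) *
  (free_lift (e 8) = lie x2 (lie x2 (lie x1 x2))).
Proof.
have liftE n (lt_n : (n < 8)%N) :
    free_lift (e n.+1) = tnth hall_tuple (Ordinal lt_n).
  exact: (free_lift_e (Ordinal lt_n)).
by do !split; rewrite liftE.
Qed.

Hypothesis nil_g : step_nilpotent g 4.

Lemma lie5_0 y1 y2 y3 y4 y5 : lie y1 (lie y2 (lie y3 (lie y4 y5))) = 0 :> g.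
Proof. by apply: nil_g; do 4!apply: lie_span_lie => //. Qed.

(** By Jacobi, ad of a bracket is the commutator of the ads, so compatibility with
ad u and ad v passes to ad [u,v]. *)
Lemma free_lift_lie_closed u v :
    (forall w, free_lift (lie u w) = lie (free_lift u) (free_lift w)) ->
    (forall w, free_lift (lie v w) = lie (free_lift v) (free_lift w)) ->
  forall w,
    free_lift (lie (lie u v) w) = lie (free_lift (lie u v)) (free_lift w).
Proof.
move=> hom_u hom_v w.
by rewrite hom_u !lie_lie linearB /= !(hom_u, hom_v).
Qed.

(** Since e1 and e2 generate, it suffices to compare ad e1 and ad e2 on the basis.
The two entries for x_7 agree because [x_3,x_3] = 0. *)
Lemma free_lift_hom : lie_hom free_lift.
Proof.
have lie_symm : lie x2 (lie x1 (lie x1 x2)) = lie x1 (lie x2 (lie x1 x2)).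
  by apply/eqP; rewrite eq_sym -subr_eq0 -lie_lie liexx.
have span_e (P : free_nil4 k -> Prop) :
   (forall c u v, P u -> P v -> P (c *: u + v)) -> P 0 ->
   (forall i : 'I_8, P (e i.+1)) -> forall v, P v.
  move=> PZD P0 Pe v; rewrite (decomp v).
  by elim/big_rec: _ => // i u _ Pu; apply: PZD.
have hom_e12 a :
    (forall i : 'I_8,
      free_lift (lie a (e i.+1)) = lie (free_lift a) (free_lift (e i.+1))) ->
    forall w, free_lift (lie a w) = lie (free_lift a) (free_lift w).
  move=> hom_e; apply: span_e => // [c u v hu hv|].
    by rewrite lieDr lieZr !linearP /= lieDr lieZr hu hv.
  by rewrite lie0r !linear0 lie0r.
have hom_e1 :
    forall w, free_lift (lie (e 1) w) = lie (free_lift (e 1)) (free_lift w).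
  apply: hom_e12 => -[[|[|[|[|[|[|[|[|i]]]]]]]] lt_i] //=;
  by rewrite ?liexx ?lie_e ?lie_e0 ?linear0 ?free_lift_eE ?lie5_0
    ?lie_symm ?liexx.
have e21 : lie (e 2) (e 1) = - e 3 by rewrite lie_antisym lie_e.
have x21 := lie_antisym x2 x1.
have hom_e2 :
    forall w, free_lift (lie (e 2) w) = lie (free_lift (e 2)) (free_lift w).
  apply: hom_e12 => -[[|[|[|[|[|[|[|[|i]]]]]]]] lt_i] //=;
  by rewrite ?liexx ?e21 ?lie_e ?lie_e0 ?linear0 ?linearN /= ?free_lift_eE
    ?lie5_0 ?x21 ?liexx.
have hom_e3 := free_lift_lie_closed hom_e1 hom_e2; rewrite lie_e in hom_e3.
have hom_e4 := free_lift_lie_closed hom_e1 hom_e3; rewrite lie_e in hom_e4.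
have hom_e5 := free_lift_lie_closed hom_e2 hom_e3; rewrite lie_e in hom_e5.
have hom_e6 := free_lift_lie_closed hom_e1 hom_e4; rewrite lie_e in hom_e6.
have hom_e7 := free_lift_lie_closed hom_e2 hom_e4; rewrite lie_e in hom_e7.
have hom_e8 := free_lift_lie_closed hom_e2 hom_e5; rewrite lie_e in hom_e8.
apply: span_e => [c u v hu hv w||].
- by rewrite lieDl lieZl !linearP /= lieDl lieZl hu hv.
- by move=> w; rewrite linear0 !(bil0l (@lie_bilinear k _)) linear0.
- by case=> [[|[|[|[|[|[|[|[|i]]]]]]]] lt_i].
Qed.

End Lift.

(** * The theorem *)

Theorem proposition2p6 (k : fieldType) (g : lieAlgType k) (x1 x2 : g)
    (char0 : [pchar k] =i pred0)
    (free_g : free_step_nilpotent 4 [tuple x1; x2]) :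
  (exists x3 x4 x5 x6 x7 x8 : g,
     [/\ lie_basis [tuple x1; x2; x3; x4; x5; x6; x7; x8],
         [/\ x3 = lie x1 x2, x4 = lie x1 x3 & x5 = lie x2 x3],
         [/\ x6 = lie x1 x4, x7 = lie x2 x4, x7 = lie x1 x5 & x8 = lie x2 x5],
         (forall v, v \in [:: x6; x7; x8] -> lie x1 v = 0 /\ lie x2 v = 0)
       & (forall u v, u \in [:: x3; x4; x5; x6; x7; x8] ->
            v \in [:: x3; x4; x5; x6; x7; x8] -> lie u v = 0)]) /\
  step_solvable g 2 /\
  ~ (exists mul : g -> g -> g, novikov_structure mul).
Proof.
have [nil_g free] := free_g.
pose s := free_lift x1 x2.
have hom_s u v : s (lie u v) = lie (s u) (s v) by exact: free_lift_hom.
have [f [hom_f f_x _]] :=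
  free _ [tuple std k 1; std k 2] (@free_nil4_nilpotent k).
have [f1 f2] : f x1 = std k 1 /\ f x2 = std k 2 by have [] := congr1 val f_x.
(* Both s o f and the identity fix x1 and x2, so they agree. *)
have fK : cancel f s.
  have [idg [_ _ unique]] := free _ [tuple x1; x2] nil_g.
  move=> u; have id_hom : lie_hom (idfun : {linear g -> g}) by [].
  have id_x : map_tuple idfun [tuple x1; x2] = [tuple x1; x2] by apply: val_inj.
  rewrite -[RHS]/((idfun : {linear g -> g}) u) (unique _ id_hom id_x).
  apply: (unique (s \o f)) => [a b|] /=; first by rewrite hom_f; exact: hom_s.
  by apply: val_inj; rewrite /= f1 f2 !free_lift_eE.
have sK : cancel s f.
  have f_e i : f (tnth (hall_tuple x1 x2) i) = std k i.+1.
    by case: i => [[|[|[|[|[|[|[|[|i]]]]]]]] lt_i] //=;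
      rewrite (tnth_nth 0) /= !hom_f f1 f2 !lie_e.
  move=> v; rewrite [RHS]decomp /s /free_lift linear_sum.
  by apply: eq_bigr => i _; rewrite linearZ /= f_e /coord inord_val.
split; last split.
- have s_eE := free_lift_eE x1 x2.
  exists (s (std k 3)), (s (std k 4)), (s (std k 5)).
  exists (s (std k 6)), (s (std k 7)), (s (std k 8)).
  have s_derived u : u \in [seq s (std k i) | i <- iota 3 6] ->
      exists2 w, in_derived w & u = s w.
    case/mapP=> i; rewrite mem_iota => i_range ->.
    by exists (std k i) => //; apply: e_derived.
  split.
  + rewrite /s !s_eE; split=> [v|c sc0].
      by exists (f v); exact: esym (fK v).
    by rewrite -[c]sK [s c]sc0 linear0.
  + by rewrite /s !s_eE.
  + have s15 : s (std k 7) = lie x1 (s (std k 5)).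
      by rewrite -(lie_e k).1.2 hom_s {1}/s s_eE.
    by split=> //; rewrite /s !s_eE.
  + by move=> v; rewrite /s !inE !s_eE => /or3P[]/eqP->; rewrite !lie5_0.
  + move=> u v /s_derived[w w_der ->] /s_derived[w' w'_der ->].
    by rewrite -hom_s lie_derived0 // /s linear0.
- exact: (step_solvable_inj hom_f (can_inj fK) (@free_nil4_solvable k)).
- case=> mul /(novikov_structure_iso hom_f fK sK) nov.
  have nz n : (n.+1%:R : k) != 0 by rewrite (pcharf0P k).1.
  exact: novikov_free_nil4_false nov (nz 1%N) (nz 2%N).
Qed.
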